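(* Let $k$ be a positive integer. Every $(2k+1)$-connected semicomplete digraph $D$ with $\delta^+(D)\ge 10^7k^4$ is $k$-linked.
   Context: All digraphs are finite and simple. A semicomplete digraph is a digraph in which every pair of distinct vertices is joined by at least one arc (possibly one in each direction). A digraph is $k$-connected if it has at least $k+1$ vertices and, for every set $S$ of at most $k-1$ vertices and every pair of distinct vertices $x,y\notin S$, there is a directed path from $x$ to $y$ in $D-S$. A digraph $D$ is $k$-linked if for every $2k$-tuple $x_1,\dots,x_k,y_1,\dots,y_k$ of distinct vertices of $D$ there exist $k$ pairwise vertex-disjoint directed paths $P_1,\dots,P_k$ with $P_i$ starting at $x_i$ and ending at $y_i$ for each $i\in[k]$. $\delta^+(D)$ denotes the minimum out-degree of $D$. *)

(* Defs.v *)
From mathcomp Require Import all_boot.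
Set Implicit Arguments. Unset Strict Implicit. Unset Printing Implicit Defensive.

(* A digraph on a finite vertex type T is given by its arc relation a : rel T.
   Simple digraph: no loops (a x x = false); parallel arcs do not exist in a
   relation, and opposite arcs x->y, y->x are allowed. *)
Definition simple_digraph (T : finType) (a : rel T) : Prop := irreflexive a.

Definition semicomplete (T : finType) (a : rel T) : Prop :=
  forall x y : T, x != y -> a x y || a y x.

Definition dpath (T : finType) (a : rel T) (x y : T) (p : seq T) : bool :=
  [&& path a x p, last x p == y & uniq (x :: p)].

Definition k_connected (T : finType) (a : rel T) (k : nat) : Prop :=
  k.+1 <= #|T| /\
  forall (S : {set T}) (x y : T), #|S| <= k.-1 -> x != y -> x \notin S -> y \notin S ->
    exists p : seq T, dpath a x y p && [disjoint (x :: p) & S].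

Definition outdeg (T : finType) (a : rel T) (x : T) : nat := #|[set y | a x y]|.
Definition min_outdeg_ge (T : finType) (a : rel T) (d : nat) : Prop :=
  forall x : T, d <= outdeg a x.

Definition k_linked (T : finType) (a : rel T) (k : nat) : Prop :=
  forall xs ys : 'I_k -> T,
    injective xs -> injective ys -> (forall i j, xs i != ys j) ->
    exists P : 'I_k -> seq T,
      (forall i, dpath a (xs i) (ys i) (P i)) /\
      (forall i j, i != j -> [disjoint (xs i :: P i) & (xs j :: P j)]).

(* Main.v *)
Require Import Defs.
From Stdlib Require Import Classical.
From mathcomp Require Import all_boot zify.
Set Implicit Arguments. Unset Strict Implicit. Unset Printing Implicit Defensive.

(** Let X and Y be the sources and targets, U the complement of X, and Z the
    set of 16 k^2 vertices of U \ Y of largest in-degree. Large out-degree gives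
    every vertex many short paths to each vertex of Z, so the difficulty is to
    reach Y from Z by disjoint paths which do not block the way from X to Z.
    For each x_i reserve a small set O_i through which x_i can reach Z. As U is
    (k+1)-connected, it is enough that every small minimal separator of Z from Y
    contains at most one reserved vertex. In a semicomplete digraph the
    separators are almost linearly ordered, so such O_i can be chosen greedily
    along this order, and Menger's theorem gives k disjoint paths from Z to Y
    avoiding the O_i. Choose them of minimal total length: a vertex of Z outside
    them, and each of its out-neighbours outside them, is then dominated by all
    but boundedly many of their vertices. Hence the in-degree argument still
    applies off these paths, and joins the exit of each O_i to the start of the
    right path. *)

(** * Extremal choices and in-degree counting *)

Lemma ex_min_nat (P : nat -> Prop) :
  (exists n, P n) -> exists2 n, P n & forall m, P m -> n <= m.
Proof.
case=> n; elim/ltn_ind: n => n IH Pn.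
have [[m [Pm lt_mn]]|noP] := classic (exists m, P m /\ m < n).
  exact: IH lt_mn Pm.
exists n => // m Pm; rewrite leqNgt; apply/negP => lt_mn.
by apply: noP; exists m.
Qed.

(** With [f] the in-degree this gives the set of targets; with [f] constant it merely cuts a subset
    down to a prescribed size. *)
Lemma top_set (T : finType) (f : T -> nat) (V : {set T}) m :
  m <= #|V| ->
  exists Z : {set T}, [/\ Z \subset V, #|Z| = m &
    forall z v, z \in Z -> v \in V :\: Z -> f v <= f z].
Proof.
elim: m => [|m IH] lemV.
  exists set0; split; rewrite ?sub0set ?cards0 // => z v; by rewrite inE.
have [Z [sZV cZ topZ]] := IH (ltnW lemV).
have /card_gt0P [v0 v0V] : 0 < #|V :\: Z|.
  by rewrite cardsD (setIidPr sZV) cZ subn_gt0.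
case: (arg_maxnP f v0V) => w wVZ wmax.
have /setDP [wV wNZ] : w \in V :\: Z by [].
exists (w |: Z); split.
- by rewrite subUset sub1set wV.
- by rewrite cardsU1 wNZ cZ.
move=> z v /setU1P [->|zZ]; rewrite !inE negb_or => /andP [/andP [_ vNZ] vV].
  by apply: wmax; apply/setDP.
by apply: topZ => //; apply/setDP.
Qed.

Lemma sum_indicator (T : finType) (W : {set T}) (P : pred T) :
  \sum_(v in W) (P v : nat) = #|[set v in W | P v]|.
Proof.
rewrite -sum1_card big_mkcond [RHS]big_mkcond /=.
by apply: eq_bigr => v _; rewrite inE; case: (v \in W); case: (P v).
Qed.

(** Double counting inside the set [W0] of these vertices: every ordered pair of distinct vertices
    carries an arc one way or the other, while each vertex of [W0] receives at most [c] arcs. So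
    [#|W0| * (#|W0| - 1)] is at most [2 * c * #|W0|]. *)
Lemma few_low_indeg (T : finType) (a : rel T) (W : {set T}) c :
  semicomplete a ->
  #|[set w in W | #|[set v in W | a v w]| <= c]| <= 2 * c + 1.
Proof.
move=> sc; set W0 := [set w in W | _].
have le1 : \sum_(w in W0) \sum_(v in W0) (a v w : nat) <= #|W0| * c.
  rewrite -sum_nat_const; apply: leq_sum => w; rewrite inE => /andP [_].
  apply: leq_trans; rewrite sum_indicator; apply: subset_leq_card.
  by apply/subsetP => v; rewrite !inE => /andP [/andP [-> _] ->].
have le2 : \sum_(w in W0) \sum_(v in W0) (v != w : nat) <=
    \sum_(w in W0) \sum_(v in W0) (a v w : nat) +
    \sum_(w in W0) \sum_(v in W0) (a w v : nat).
  rewrite -big_split; apply: leq_sum => w _.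
  rewrite -big_split; apply: leq_sum => v _ /=.
  by case: eqVneq => //= /sc; case: (a v w); case: (a w v).
have eq3 : \sum_(w in W0) \sum_(v in W0) (v != w : nat) = #|W0| * #|W0|.-1.
  rewrite -sum_nat_const; apply: eq_bigr => w wW.
  rewrite sum_indicator (cardsD1 w W0) wW /=; apply: eq_card => v.
  by rewrite !inE andbC.
rewrite eq3 [X in _ + X]exchange_big /= in le2.
have := leq_trans le2 (leq_add le1 le1).
by rewrite addnn -mul2n; clear; case: #|W0| => [|n] /=; nia.
Qed.

Lemma card_bigcup_le (T I : finType) (W : {set I}) (F : I -> {set T}) c :
  (forall i, i \in W -> #|F i| <= c) -> #|\bigcup_(i in W) F i| <= #|W| * c.
Proof.
move=> leF; rewrite -sum_nat_const.
elim/big_rec2: _ => [|i n A iW IH]; first by rewrite cards0.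
apply: leq_trans (leq_card_setU _ _) _; exact: leq_add (leF _ iW) IH.
Qed.

(* Otherwise every in-neighbour of z outside F dominates all of A, so a vertex
   of A with large in-degree inside A has larger in-degree than z. *)
Lemma access (T : finType) (a : rel T) (U A F : {set T}) z s :
  irreflexive a -> semicomplete a -> A \subset U -> F \subset U ->
  [disjoint A & F] ->
  (forall v, v \in A -> #|[set u in F | ~~ a u v]| <= s) ->
  (forall v, v \in A ->
     #|[set u in U | a u v]| <= #|[set u in U | a u z]|) ->
  2 * s + 2 <= #|A| ->
  exists2 v, v \in A & a v z \/ exists b, [/\ b \in U :\: F, a v b & a b z].
Proof.
move=> irr sc sAU sFU dAF leF topz bigA.
apply: NNPP => noacc.
have noz v : v \in A -> ~~ a v z.
  by move=> vA; apply/negP => avz; apply: noacc; exists v => //; left.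
have nob v b : v \in A -> b \in U :\: F -> a b z -> ~~ a v b.
  move=> vA bU abz; apply/negP => avb; apply: noacc; exists v => //.
  by right; exists b.
(* At most [2 * s + 1] vertices of [A] have in-degree at most [s] inside [A], one fewer than [A]
   has. *)
have [v vA hi] : exists2 v, v \in A & s < #|[set u in A | a u v]|.
  apply: NNPP => lo; suff : #|A| <= 2 * s + 1 by lia.
  apply: leq_trans (few_low_indeg A s sc); apply: subset_leq_card.
  apply/subsetP => v vA; rewrite inE vA leqNgt; apply/negP => hi.
  by apply: lo; exists v.
have := topz v vA; apply/negP; rewrite -ltnNge.
set Nz := [set u in U | a u z].
have le1 : #|Nz| <= #|Nz :\: F| + (#|[set u in F | a u v]| + s).
  rewrite -(cardsID F Nz) addnC leq_add2l.
  apply: leq_trans (leq_add (leqnn _) (leF v vA)).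
  apply: leq_trans (leq_card_setU _ _); apply: subset_leq_card.
  by apply/subsetP => u; rewrite !inE; case: (u \in F); rewrite ?andbF //= orbN.
(* Three disjoint sets of in-neighbours of [v] are collected: in-neighbours of [z] outside [F],
   vertices of [F], and more than [s] vertices of [A]. Together they outnumber [Nz]. *)
have d1 : #|(Nz :\: F) :|: [set u in F | a u v]| =
    #|Nz :\: F| + #|[set u in F | a u v]|.
  rewrite cardsU [_ :&: _](_ : _ = set0) ?cards0 ?subn0 //.
  by apply/setP => u; rewrite !inE; case: (u \in F); rewrite ?andbF.
have d2 : #|(Nz :\: F) :|: [set u in F | a u v] :|: [set u in A | a u v]| =
    #|Nz :\: F| + #|[set u in F | a u v]| + #|[set u in A | a u v]|.
  rewrite cardsU [_ :&: _](_ : _ = set0) ?cards0 ?subn0 ?d1 //.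
  apply/setP => u; rewrite !inE; case uA: (u \in A); last by rewrite andbF.
  by rewrite (disjointFr dAF uA) (negPf (noz u uA)) !andbF.
suff le3 : #|(Nz :\: F) :|: [set u in F | a u v] :|: [set u in A | a u v]| <=
    #|[set u in U | a u v]| by lia.
apply: subset_leq_card; apply/subsetP => u; rewrite !inE.
case/orP => [/orP [/and3P [uF uU auz]|/andP [uF ->]]|/andP [uA ->]].
- have nvu : ~~ a v u by apply: nob => //; rewrite inE uF.
  have neq : v != u by apply/eqP => E; move: auz; rewrite -E (negPf (noz v vA)).
  by have := sc _ _ neq; rewrite (negPf nvu) uU.
- by rewrite (subsetP sFU).
- by rewrite (subsetP sAU).
Qed.

(** * Menger's theorem *)

(** By cardinality [f] is a bijection from [J] onto [B]. The inverse [g] serves to reindex path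
    families by their end vertices. *)
Lemma inj_in_card_section (T : finType) (J B : {set T}) (f : T -> T) :
  {in J &, injective f} -> {in J, forall i, f i \in B} -> #|B| <= #|J| ->
  exists g : T -> T, {in B, forall b, g b \in J} /\ {in B, cancel g f}.
Proof.
move=> finj fB leBJ.
have /eqP E : f @: J == B.
  rewrite eqEcard card_in_imset // leBJ andbT.
  by apply/subsetP => _ /imsetP [i iJ ->]; apply: fB.
(* The default [b] is never returned for [b] in [B], as [B] is the image of [J]. *)
pose g b := odflt b [pick i in J | f i == b].
have gP b : b \in B -> g b \in J /\ f (g b) = b.
  rewrite /g -E => /imsetP [i iJ ->].
  case: pickP => [j /andP [jJ /eqP //]|no].
  by have := no i; rewrite /= iJ eqxx.
by exists g; split=> b /gP [].
Qed.

Section Menger.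
Variable T : finType.
Implicit Types (E : {set T * T}) (A B L S : {set T}).

Definition arc_rel E : rel T := fun x y => (x, y) \in E.

(** Vertices of [A] outside [L] are included, so that for [L] disjoint from [B] every path from [A]
    to [B] meets this set. The cut condition of Menger's theorem can then be stated over sets
    [L]. *)
Definition out_bd E A L :=
  [set u | (u \notin L) && ((u \in A) || [exists l in L, arc_rel E l u])].

Lemma out_bd_start E A L u : u \in A -> u \notin L -> u \in out_bd E A L.
Proof. by rewrite inE => -> ->. Qed.

Lemma out_bd_arc E A L l u : l \in L -> arc_rel E l u -> u \notin L -> u \in out_bd E A L.
Proof.
move=> lL lu uL; rewrite inE uL; apply/orP; right.
by apply/existsP; exists l; rewrite lL.
Qed.

Lemma out_bdP E A L u : u \in out_bd E A L ->
  u \notin L /\ (u \in A \/ exists2 l, l \in L & arc_rel E l u).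
Proof.
rewrite inE => /andP [uL /orP [uA|/existsP [l /andP [lL lu]]]]; split; auto.
by right; exists l.
Qed.

(** Path [i] is [s i :: p i]. The index type is left free so that a family can be indexed by its
    first or its last vertices, which makes two families composable. *)
Record path_family (I : finType) (J : {set I}) E A B (s : I -> T) (p : I -> seq T) : Prop :=
  PathFamily {
    pf_start : forall i, i \in J -> s i \in A;
    pf_path : forall i, i \in J -> path (arc_rel E) (s i) (p i);
    pf_last : forall i, i \in J -> last (s i) (p i) \in B;
    pf_uniq : forall i, i \in J -> uniq (s i :: p i);
    pf_disj : forall i j v, i \in J -> j \in J ->
      v \in s i :: p i -> v \in s j :: p j -> i = j }.

Lemma path_family_reindex (I I' : finType) (J : {set I}) (J' : {set I'})
    E A B s p (g : I' -> I) :
  path_family J E A B s p -> {in J', forall i, g i \in J} ->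
  {in J' &, injective g} -> path_family J' E A B (s \o g) (p \o g).
Proof.
case=> h1 h2 h3 h4 h5 gJ ginj.
split=> [i /gJ/h1|i /gJ/h2|i /gJ/h3|i /gJ/h4|i j v iJ jJ vi vj] //.
by apply: ginj => //; apply: (h5 _ _ v) => //; apply: gJ.
Qed.

Lemma path_family_sub (I : finType) (J : {set I}) E E' A B s p :
  E \subset E' -> path_family J E A B s p -> path_family J E' A B s p.
Proof.
move=> sE [h1 h2 h3 h4 h5]; split=> // i iJ.
by apply: sub_path (h2 i iJ) => u v; apply: (subsetP sE).
Qed.

Lemma path_family_by_last (J : {set T}) E A B s p :
  path_family J E A B s p -> #|B| <= #|J| ->
  exists s' p', path_family B E A B s' p' /\
    {in B, forall b, last (s' b) (p' b) = b}.
Proof.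
move=> pf leBJ.
have finj : {in J &, injective (fun i => last (s i) (p i))}.
  move=> i j iJ jJ eq_l; apply: (pf_disj pf iJ jJ (mem_last _ _)).
  by rewrite eq_l mem_last.
have [g [gJ gK]] := inj_in_card_section finj (pf_last pf) leBJ.
exists (s \o g), (p \o g); split=> [|b /gK //].
apply: path_family_reindex pf gJ _ => b b' bB b'B eq_g.
by rewrite -(gK b) // -(gK b') // eq_g.
Qed.

Lemma path_family_by_start (J : {set T}) E A B s p :
  path_family J E A B s p -> #|A| <= #|J| ->
  exists s' p', path_family A E A B s' p' /\ {in A, s' =1 id}.
Proof.
move=> pf leAJ.
have finj : {in J &, injective s}.
  move=> i j iJ jJ eq_s; apply: (pf_disj pf iJ jJ (mem_head _ _)).
  by rewrite eq_s mem_head.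
have [g [gJ gK]] := inj_in_card_section finj (pf_start pf) leAJ.
exists (s \o g), (p \o g); split=> [|b /gK //].
apply: path_family_reindex pf gJ _ => b b' bB b'B eq_g.
by rewrite -(gK b) // -(gK b') // eq_g.
Qed.

(** A path can leave [L] only through [S], and here it meets [S] at most in its last vertex. *)
Lemma path_stay (e : rel T) L S u p :
  (forall v w, v \in L -> e v w -> w \in L :|: S) ->
  path e u p -> u \in L :|: S -> {in belast u p, forall v, v \notin S} ->
  {in u :: p, forall v, v \in L :|: S}.
Proof.
move=> eLS; elim: p u => [|w p IH] u /=.
  by move=> _ uLS _ v; rewrite inE => /eqP ->.
case/andP=> uw pw uLS noS v; rewrite inE => /predU1P [-> //|].
apply: IH => // [|x xp]; last by apply: noS; rewrite inE xp orbT.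
apply: eLS uw; case/setUP: uLS => // uS.
by have := noS u (mem_head _ _); rewrite uS.
Qed.

(** Going back from the end: a vertex of [L] would have its successor in [L] or in [S], both
    excluded. *)
Lemma path_avoid (e : rel T) L S u p :
  (forall v w, v \in L -> e v w -> w \in L :|: S) ->
  path e u p -> last u p \notin L -> {in p, forall v, v \notin S} ->
  {in u :: p, forall v, v \notin L}.
Proof.
move=> eLS; elim: p u => [|w p IH] u /=.
  by move=> _ uL _ v; rewrite inE => /eqP ->.
case/andP=> uw pw lL noS.
have IHw : {in w :: p, forall v, v \notin L}.
  by apply: IH => // x xp; apply: noS; rewrite inE xp orbT.
move=> v; rewrite inE => /predU1P [->|]; last exact: IHw.
apply/negP => uL; have := eLS _ _ uL uw; rewrite inE.
by rewrite (negPf (IHw w (mem_head _ _))) (negPf (noS w (mem_head _ _))).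
Qed.

(** The first family stays in [L :|: S] and the second avoids [L], so they meet only in [S], where a
    path of the first ends and one of the second starts. The arc [(x, y)] joins the remaining two
    paths. *)
Lemma menger_glue E A B L x y s1 p1 s2 p2 :
  let S := out_bd E A L in
  x \in L -> y \notin L -> y \notin S -> [disjoint L & B] ->
  path_family (x |: S) E A (x |: S) s1 p1 ->
  {in x |: S, forall i, last (s1 i) (p1 i) = i} ->
  path_family (y |: S) E (y |: S) B s2 p2 -> {in y |: S, s2 =1 id} ->
  exists s p, path_family (x |: S) ((x, y) |: E) A B s p.
Proof.
move=> S xL yL yS dLB pf1 last1 pf2 start2.
have eLS v w : v \in L -> arc_rel E v w -> w \in L :|: S.
  rewrite inE => vL vw; case: (boolP (w \in L)) => //= wL.
  exact: out_bd_arc vL vw wL.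
have S_notL v : v \in S -> v \notin L by case/out_bdP.
have xS : x \notin S by apply/negP => /S_notL; rewrite xL.
have end1 i v : i \in x |: S -> v \in s1 i :: p1 i -> v \in x |: S -> v = i.
  move=> iS vi vS; symmetry; apply: (pf_disj pf1 iS vS vi).
  by rewrite -{1}(last1 v vS) mem_last.
have fam1 i v : i \in x |: S -> v \in s1 i :: p1 i -> v \in L :|: S.
  move=> iS; move: v; apply: (path_stay eLS (pf_path pf1 iS)).
    rewrite inE; case: (boolP (s1 i \in L)) => //= sL.
    exact: out_bd_start (pf_start pf1 iS) sL.
  move=> v vb; apply/negP => vS.
  have vi : v = i by apply: (end1 i v) => //; [apply: mem_belast | rewrite inE vS orbT].
  have := pf_uniq pf1 iS; rewrite lastI rcons_uniq (last1 i iS) => /andP [ib _].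
  by rewrite vi in vb; rewrite vb in ib.
have head2 j v : j \in y |: S -> v \in j :: p2 j -> v \in y |: S -> v = j.
  move=> jS vj vS; symmetry; apply: (pf_disj pf2 jS vS (v := v)).
    by rewrite start2.
  by rewrite (start2 v vS) mem_head.
have fam2 j v : j \in y |: S -> v \in j :: p2 j -> v \notin L.
  move=> jS; have uj := pf_uniq pf2 jS; rewrite start2 // in uj.
  move: v; have := pf_path pf2 jS; rewrite start2 // => pj.
  apply: (path_avoid eLS pj).
    have := pf_last pf2 jS; rewrite start2 // => lB; apply/negP => lL.
    by rewrite (disjointFr dLB lL) in lB.
  move=> v vp; apply/negP => vS.
  have vj : v = j by apply: (head2 j v) => //; rewrite inE ?vp ?vS orbT.
  by rewrite vj in vp; move: uj; rewrite /= vp.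
pose t i := if i == x then y else i.
have tS i : i \in x |: S -> t i \in y |: S.
  rewrite /t !inE; case: eqVneq => [_|_ /= iS]; first by rewrite eqxx.
  by apply/orP; right.
have meet i j v : i \in x |: S -> j \in x |: S ->
    v \in s1 i :: p1 i -> v \in t j :: p2 (t j) -> i = j /\ i != x /\ v = i.
  move=> iS jS vi vj; have vL := fam2 _ _ (tS j jS) vj.
  have vS : v \in S by have := fam1 _ _ iS vi; rewrite inE (negPf vL).
  have vei : v = i by apply: end1 iS vi _; rewrite inE vS orbT.
  have vtj : v = t j by apply: head2 (tS j jS) vj _; rewrite inE vS orbT.
  have nix : i != x by apply/eqP => ix; rewrite -ix -vei vS in xS.
  split=> //; move: vtj; rewrite /t; case: eqVneq => [_ vy|_ vj']; last by rewrite -vei.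
  by rewrite -vy vS in yS.
pose p i := if i == x then p1 x ++ y :: p2 y else p1 i ++ p2 i.
have memp i v : i \in x |: S -> v \in s1 i :: p i ->
    v \in s1 i :: p1 i \/ v \in t i :: p2 (t i).
  rewrite /p /t => iS; case: eqVneq => [->|nix];
    rewrite -cat_cons mem_cat => /orP [vi|vi]; auto.
  by right; rewrite inE vi orbT.
have yS_x : y \notin x |: S.
  by apply/setU1P => -[yx|]; [rewrite yx xL in yL | apply/negP].
have sE : E \subset (x, y) |: E by apply: subsetUr.
have subp u q : path (arc_rel E) u q -> path (arc_rel ((x, y) |: E)) u q.
  by apply: sub_path => v w; apply: (subsetP sE).
exists s1, p; split=> [i iS|i iS|i iS|i iS|i j v iS jS].
- exact: (pf_start pf1 iS).
- have p1i := subp _ _ (pf_path pf1 iS); have li := last1 i iS.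
  have := subp _ _ (pf_path pf2 (tS i iS)); rewrite (start2 _ (tS i iS)) /p /t.
  case: eqVneq iS li p1i => [->|nix] iS li p1i p2i; rewrite cat_path p1i li //=.
  by rewrite p2i andbT /arc_rel setU11.
- have li := last1 i iS; have := pf_last pf2 (tS i iS).
  rewrite (start2 _ (tS i iS)) /p /t; case: eqVneq iS li => [->|nix] iS li;
  by rewrite last_cat ?li.
- have u1 := pf_uniq pf1 iS; have := pf_uniq pf2 (tS i iS).
  rewrite (start2 _ (tS i iS)); have mi := meet i i _ iS iS.
  move: mi; rewrite /p /t; case: eqVneq iS u1 => [->|nix] iS u1 mi u2;
    rewrite -cat_cons cat_uniq u1 andTb.
    rewrite u2 andbT; apply/negP => /hasP [v v2 v1].
    by have [_ []] := mi v v1 v2.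
  move: (u2); rewrite cons_uniq => /andP [ip ->]; rewrite andbT; apply/negP => /hasP [v v2 v1].
  have [|_ [_ vi]] := mi v v1; first by rewrite inE v2 orbT.
  by rewrite vi in v2; rewrite v2 in ip.
- move=> /(memp _ _ iS) [vi|vi] /(memp _ _ jS) [vj|vj].
  + exact: (pf_disj pf1 iS jS vi vj).
  + by have [] := meet i j v.
  + by have [] := meet j i v.
  have : t i = t j.
    by apply: (pf_disj pf2 (tS i iS) (tS j jS) (v := v)); rewrite start2 ?tS.
  rewrite /t; case: eqVneq => [->|ni]; case: eqVneq => [->|nj] // Eij.
    by move: jS; rewrite -Eij (negPf yS_x).
  by move: iS; rewrite Eij (negPf yS_x).
Qed.

(* Goering's induction on the number of arcs: if deleting (x, y) destroys the
   cut condition, a too small boundary S splits the problem into linking A to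
   x |: S and y |: S to B. *)
Theorem menger E A B k :
  (forall L, [disjoint L & B] -> k <= #|out_bd E A L|) ->
  exists (J : {set T}) s p, #|J| = k /\ path_family J E A B s p.
Proof.
have [n] := ubnP #|E|; elim: n E A B => // n IH E A B leEn cut.
have [E0|[[x y] xyE]] := set_0Vmem E.
  (* Without arcs, the cut [~: B] has its boundary inside [A :&: B], whose vertices are one-vertex
     paths. *)
  have leAB : k <= #|A :&: B|.
    apply: leq_trans (cut (~: B) _) _.
      by rewrite -setI_eq0 setIC setICr.
    apply: subset_leq_card; apply/subsetP => u /out_bdP [].
    rewrite !inE negbK => -> [->//|[l _]]; by rewrite /arc_rel E0 inE.
  have [J [sJ cJ _]] := top_set (fun=> 0) leAB.
  exists J, id, (fun=> [::]); split=> //; split=> // [i iJ|i iJ|i j v _ _].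
  - by have /setIP [] := subsetP sJ i iJ.
  - by have /setIP [] := subsetP sJ i iJ.
  - by rewrite !inE => /eqP -> /eqP.
set E' := E :\ (x, y).
have EE' : E = (x, y) |: E' by rewrite setD1K.
have ltE' : #|E'| < n by move: leEn; rewrite (cardsD1 (x, y) E) xyE.
have arcE u v : arc_rel E u v -> arc_rel E' u v \/ u = x /\ v = y.
  rewrite /arc_rel EE' !inE => /orP [/eqP [-> ->]|]; auto.
have [cut'|ncut] := classic (forall L, [disjoint L & B] -> k <= #|out_bd E' A L|).
  have [J [s [p [cJ pf]]]] := IH _ _ _ ltE' cut'.
  exists J, s, p; split=> //; apply: path_family_sub pf; exact: subsetDl.
have [L nL] := not_all_ex_not _ _ ncut.
have [dLB /negP] := imply_to_and _ _ nL.
rewrite -ltnNge; set S := out_bd E' A L => ltS.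
(* Restoring the arc [(x, y)] adds at most [y] to the boundary. As [S] is too small, [y] is really
   added, and [S] has exactly [k - 1] elements. *)
have sub_bd u : u \in out_bd E A L -> u \in S \/ u = y /\ x \in L.
  case/out_bdP => uL [uA|[l lL /arcE [lu|[Elx ->]]]].
  - by left; apply: out_bd_start.
  - by left; apply: out_bd_arc lu uL.
  - by right; rewrite -Elx.
have [xL yS yL] : [/\ x \in L, y \notin S & y \notin L].
  have hcut := cut L dLB.
  have : ~~ (out_bd E A L \subset S).
    by apply/negP => /subset_leq_card; lia.
  case/subsetPn => u u1 uS; have [uL _] := out_bdP u1.
  by case: (sub_bd u u1) uS uL => [->//|[-> xL] yS yL].
have cS : #|S|.+1 = k.
  apply/eqP; rewrite eqn_leq ltS; apply: leq_trans (cut L dLB) _.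
  apply: (@leq_trans #|y |: S|); last by rewrite cardsU1 yS.
  apply: subset_leq_card; apply/subsetP => u /sub_bd [uS|[-> _]];
  by rewrite inE ?uS ?orbT // inE eqxx.
have xS : x \notin S by apply/negP => /out_bdP []; rewrite xL.
have cxS : #|x |: S| = k by rewrite cardsU1 xS.
have cyS : #|y |: S| = k by rewrite cardsU1 yS.
(* The [E]-boundary of [M :&: L] lies in the [E']-boundary of [M]; the deleted arc is harmless
   because [x] is not in [M]. *)
have cut1 (M : {set T}) : [disjoint M & x |: S] -> k <= #|out_bd E' A M|.
  move=> dM; have xM : x \notin M.
    by apply/negP => xM; have := disjointFr dM xM; rewrite !inE eqxx.
  have SM u : u \in S -> u \notin M.
    by move=> uS; apply/negP => uM; have := disjointFr dM uM; rewrite inE uS orbT.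
  apply: leq_trans (cut (M :&: L) _) (subset_leq_card _).
    by apply: disjointWl dLB; apply: subsetIr.
  apply/subsetP => u /out_bdP [uML].
  have uM : u \in L -> u \notin M by move: uML; rewrite inE; case: (u \in L); rewrite ?andbT.
  have uN : u \in S -> u \notin M by apply: SM.
  case=> [uA|[l]].
    apply: out_bd_start => //; case: (boolP (u \in L)) => [/uM //|uL].
    by apply: uN; apply: out_bd_start.
  case/setIP => lM lL /arcE [lu|[Elx _]]; last by rewrite -Elx lM in xM.
  apply: (out_bd_arc _ lM lu); case: (boolP (u \in L)) => [/uM //|uL].
  by apply: uN; apply: (out_bd_arc _ lL lu uL).
(* On the other side [L :|: M] is the cut to test, since its boundary is caught by [y |: S] or by
   arcs leaving [M]. *)
have cut2 (M : {set T}) : [disjoint M & B] -> k <= #|out_bd E' (y |: S) M|.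
  move=> dM; apply: leq_trans (cut (L :|: M) _) (subset_leq_card _).
    by rewrite -setI_eq0 setIUl setU_eq0 !setI_eq0 dLB.
  apply/subsetP => u /out_bdP []; rewrite inE negb_or => /andP [uL uM] [uA|[l lLM]].
    by apply: out_bd_start => //; rewrite inE (out_bd_start _ uA uL) orbT.
  case/arcE => [lu|[_ uy]]; last first.
    by apply: out_bd_start => //; rewrite uy !inE eqxx.
  case/setUP: lLM => [lL|lM]; last exact: (out_bd_arc _ lM lu uM).
  by apply: out_bd_start => //; rewrite inE (out_bd_arc _ lL lu uL) orbT.
have [J1 [s1 [p1 [cJ1 pf1]]]] := IH _ _ _ ltE' cut1.
have [J2 [s2 [p2 [cJ2 pf2]]]] := IH _ _ _ ltE' cut2.
have [|s1' [p1' [pf1' last1]]] := path_family_by_last pf1; first by rewrite cxS cJ1.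
have [|s2' [p2' [pf2' start2]]] := path_family_by_start pf2; first by rewrite cyS cJ2.
have [s [p pf]] := menger_glue xL yL yS dLB pf1' last1 pf2' start2.
by exists (x |: S), s, p; rewrite EE'.
Qed.

End Menger.

(** * Separations of semicomplete digraphs *)

Section Separations.
Variables (T : finType) (a : rel T) (U Z Y : {set T}).
Hypothesis sc : semicomplete a.
Implicit Types (L : {set T}) (c : nat).

(** Vertices of [Z] outside [L] count as boundary, so that paths inside [U] from [Z] to [right L]
    meet it wherever they start. *)
Definition bdry L := [set u in U :\: L | (u \in Z) || [exists l in L, a l u]].
Definition right L := U :\: (L :|: bdry L).
(* [bdry L] separates L from [right L] inside U. The last clause of [tight]
   makes this separator minimal towards Y. *)
Definition tight c L :=
  [&& L \subset U :\: Y, #|bdry L| <= c &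
      [forall u in bdry L :\: Y, exists w in right L, a u w]].

Lemma bdryP L u : reflect
  [/\ u \in U, u \notin L & u \in Z \/ exists2 l, l \in L & a l u]
  (u \in bdry L).
Proof.
rewrite !inE; apply: (iffP andP) => [[/andP [uL uU] h]|[uU uL h]].
  split=> //; case/orP: h => [|/existsP [l /andP [lL lu]]]; auto.
  by right; exists l.
split; first by rewrite uL.
case: h => [->//|[l lL lu]]; apply/orP; right.
by apply/existsP; exists l; rewrite lL.
Qed.

Lemma bdry_arc L l u : u \in U -> u \notin L -> l \in L -> a l u -> u \in bdry L.
Proof. by move=> uU uL lL lu; apply/bdryP; split=> //; right; exists l. Qed.

Lemma rightP L u : reflect [/\ u \in U, u \notin L & u \notin bdry L] (u \in right L).
Proof.
rewrite in_setD in_setU negb_or.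
by apply: (iffP andP) => [[/andP [uL ub] uU]|[uU uL ub]]; rewrite ?uL.
Qed.

Lemma right_no_arc L l u : l \in L -> u \in right L -> ~~ a l u.
Proof.
move=> lL /rightP [uU uL]; apply: contra; exact: (bdry_arc uU uL lL).
Qed.

Lemma right_dom L l u : l \in L -> u \in right L -> a u l.
Proof.
move=> lL uR; have := right_no_arc lL uR.
have /sc : l != u by apply: contraTneq uR => <-; apply/rightP; rewrite lL => -[].
by case: (a l u).
Qed.

Lemma right_start L u : u \in right L -> u \notin Z.
Proof.
case/rightP=> uU uL; apply: contra => uZ; apply/bdryP; split; auto.
Qed.

Lemma tightP c L : tight c L ->
  [/\ L \subset U, #|bdry L| <= c, [disjoint L & Y] &
    forall u, u \in bdry L -> u \notin Y -> exists2 w, w \in right L & a u w].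
Proof.
rewrite /tight subsetD => /and3P [/andP [sLU dLY] le_c /forallP h].
split=> // u ub uY; have := h u; rewrite inE ub uY /=.
by case/existsP => w /andP [wR uw]; exists w.
Qed.

Lemma tight_leq c c' L : tight c L -> #|bdry L| <= c' -> tight c' L.
Proof. by case/and3P=> sL _ h le_c'; apply/and3P. Qed.

(* Semicompleteness makes any two separations almost nested. *)
Lemma right_cross L L' : [disjoint L & right L'] \/ [disjoint L' & right L].
Proof.
case: (boolP [disjoint L & right L']); [by left|rewrite -setI_eq0].
case/set0Pn => p /setIP [pL pR']; right; rewrite -setI_eq0; apply/set0Pn.
case=> r /setIP [rL' rR].
by have := right_no_arc rL' pR'; rewrite (right_dom pL rR).
Qed.

Lemma right_notin L u : u \in U -> (u \in right L) = (u \notin L :|: bdry L).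
Proof. by move=> uU; rewrite in_setD uU andbT. Qed.

(** By [right_cross] one of the two differences lies in the boundary of the other set. The
    comparison of sizes transfers the bound to [L :\: L'] in either case. *)
Lemma near_nested c L L' : L \subset U -> L' \subset U ->
  #|bdry L| <= c -> #|bdry L'| <= c -> #|L| <= #|L'| -> #|L :\: L'| <= c.
Proof.
move=> sLU sL'U cL cL' leLL'; case: (right_cross L L') => [d|d].
  apply: leq_trans cL'; apply: subset_leq_card; apply/subsetP => u /setDP [uL uL'].
  have := disjointFr d uL; rewrite right_notin ?(subsetP sLU) //.
  by rewrite in_setU (negPf uL') => /negbFE.
have : #|L' :\: L| <= c.
  apply: leq_trans cL; apply: subset_leq_card; apply/subsetP => u /setDP [uL uL'].
  have := disjointFr d uL; rewrite right_notin ?(subsetP sL'U) //.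
  by rewrite in_setU (negPf uL') => /negbFE.
by have := cardsID L' L; have := cardsID L L'; rewrite setIC; lia.
Qed.

Definition late_bdry c L :=
  [set u in (L :|: bdry L) :\: Y |
    [exists L', [&& tight c L', #|L| <= #|L'| & u \in bdry L']]].

(* The two separations almost agree on L, so each such u in L has an
   out-neighbour of in-degree at most c from L; few vertices have that. *)
Lemma card_late_bdry c L : L \subset U -> #|bdry L| <= c ->
  #|late_bdry c L| <= c + (3 * c + 1) * c.
Proof.
move=> sLU cL.
pose W := [set w in L :|: bdry L | #|[set v in L | a v w]| <= c].
(* At most [2 * c + 1] such vertices lie in [L], and at most [c] on its boundary. *)
have cW : #|W| <= 3 * c + 1.
  have -> : W = [set w in L | #|[set v in L | a v w]| <= c] :|:
                [set w in bdry L | #|[set v in L | a v w]| <= c].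
    by apply/setP => w; rewrite !inE andb_orl.
  apply: leq_trans (leq_card_setU _ _) _.
  have h1 := few_low_indeg L c sc.
  have h2 : #|[set w in bdry L | #|[set v in L | a v w]| <= c]| <= c.
    by apply: leq_trans cL; apply: subset_leq_card; apply/subsetP => w; rewrite inE => /andP [].
  lia.
have cB : #|\bigcup_(w in W) [set v in L | a v w]| <= #|W| * c.
  by apply: card_bigcup_le => w; rewrite inE => /andP [].
have sub : late_bdry c L \subset bdry L :|: \bigcup_(w in W) [set v in L | a v w].
  apply/subsetP => u; rewrite inE => /andP [/setDP [uLb uY]].
  case/existsP => L' /and3P [tL' leLL' ub']; rewrite in_setU.
  case: (boolP (u \in bdry L)) => //= ub.
  have uL : u \in L by move: uLb; rewrite in_setU (negPf ub) orbF.
  have [sL'U cL' _ /(_ u ub' uY) [w wR' uw]] := tightP tL'.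
  have [wU _ _] := rightP _ _ wR'.
  apply/bigcupP; exists w; last by rewrite inE uL.
  rewrite inE; apply/andP; split.
    rewrite in_setU; case: (boolP (w \in L)) => //= wL.
    exact: (bdry_arc wU wL uL).
  apply: leq_trans (near_nested sLU sL'U cL cL' leLL'); apply: subset_leq_card.
  apply/subsetP => v; rewrite !inE => /andP [vL vw]; rewrite vL andbT.
  by apply: contraL vw => vL'; apply: right_no_arc wR'.
apply: leq_trans (subset_leq_card sub) _; apply: leq_trans (leq_card_setU _ _) _.
apply: leq_add cL _; apply: leq_trans cB _; by rewrite leq_mul2r cW orbT.
Qed.

Definition early_bdry c L :=
  [set u in right L | [exists L', [&& tight c L', #|L'| <= #|L| & u \in bdry L']]].

(** Dual to [card_late_bdry], with arcs reversed: such a [u] is not in [Z], so it has an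
    in-neighbour [l] in [L'] but not in [L]. The out-neighbours of [l] in [right L] lie in
    [L' :\: L] or [bdry L'], so there are at most [2 * c] of them; few vertices [l] are like
    that. *)
Lemma card_early_bdry c L : L \subset U -> #|bdry L| <= c ->
  #|early_bdry c L| <= (5 * c + 1) * (2 * c).
Proof.
move=> sLU cL.
pose W := [set w in right L :|: bdry L | #|[set v in right L | a w v]| <= 2 * c].
have sc' : semicomplete (fun x y => a y x) by move=> x y /sc; rewrite orbC.
have cW : #|W| <= 5 * c + 1.
  have -> : W = [set w in right L | #|[set v in right L | a w v]| <= 2 * c] :|:
                [set w in bdry L | #|[set v in right L | a w v]| <= 2 * c].
    by apply/setP => w; rewrite !inE andb_orl.
  apply: leq_trans (leq_card_setU _ _) _.
  have h1 := few_low_indeg (right L) (2 * c) sc'.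
  have h2 : #|[set w in bdry L | #|[set v in right L | a w v]| <= 2 * c]| <= c.
    by apply: leq_trans cL; apply: subset_leq_card; apply/subsetP => w; rewrite inE => /andP [].
  lia.
have cB : #|\bigcup_(w in W) [set v in right L | a w v]| <= #|W| * (2 * c).
  by apply: card_bigcup_le => w; rewrite inE => /andP [].
apply: leq_trans (_ : #|W| * (2 * c) <= _); last by rewrite leq_mul2r cW orbT.
apply: leq_trans cB; apply: subset_leq_card.
apply/subsetP => u; rewrite inE => /andP [uR /existsP [L' /and3P [tL' leL'L ub']]].
have [sL'U cL' _ _] := tightP tL'.
have [_ _] := bdryP _ _ ub'; case=> [uZ|[l lL' lu]].
  by have := right_start uR; rewrite uZ.
have lL : l \notin L by apply: contraL lu => lL; apply: right_no_arc uR.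
have lU : l \in U by apply: (subsetP sL'U).
apply/bigcupP; exists l; last by rewrite inE uR.
rewrite inE; apply/andP; split.
  by rewrite in_setU right_notin // in_setU (negPf lL) /= orNb.
have c1 := near_nested sL'U sLU cL' cL leL'L.
apply: leq_trans (_ : #|(L' :\: L) :|: bdry L'| <= _).
  apply: subset_leq_card; apply/subsetP => v; rewrite [v \in _]inE => /andP [vR lv].
  have [vU vL _] := rightP _ _ vR.
  rewrite in_setU in_setD vL /=; case: (boolP (v \in L')) => //= vL'.
  exact: (bdry_arc vU vL' lL').
by apply: leq_trans (leq_card_setU _ _) _; rewrite mul2n -addnn leq_add.
Qed.

(* Take for l v the size of the largest tight set having v on its boundary:
   processing vertices by increasing l, each one excludes few later ones. *)
Lemma conflict_bound c : exists (l : T -> nat) (Cf : T -> {set T}),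
  (forall v, #|Cf v| <= 13 * c ^ 2 + 4 * c) /\
  forall u v L, tight c L -> u \in bdry L -> v \in bdry L -> u \notin Y ->
    l v <= l u -> u \in Cf v.
Proof.
pose l v := \max_(L | tight c L && (v \in bdry L)) #|L|.
(* A largest tight set with [v] on its boundary. If there is none the value is [set0], and the test
   for tightness in the definition of [Cf] below keeps the size bound valid. *)
pose Lv v := odflt set0 [pick L | [&& tight c L, v \in bdry L & #|L| == l v]].
have LvP v L : tight c L -> v \in bdry L ->
    [/\ tight c (Lv v), v \in bdry (Lv v) & #|Lv v| = l v].
  move=> tL vL; rewrite /Lv; case: pickP => [L' /and3P [? ? /eqP]//|no].
  have : 0 < #|[pred L | tight c L && (v \in bdry L)]|.
    by apply/card_gt0P; exists L; rewrite inE tL.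
  case/(eq_bigmax_cond (fun L => #|L|)) => L'; rewrite inE => /andP [tL' vL'] e.
  by have := no L'; rewrite /= tL' vL' /= /l -e eqxx.
exists l, (fun v => if tight c (Lv v) then late_bdry c (Lv v) :|: early_bdry c (Lv v) else set0).
split=> [v|u v L tL ub vb uY lvu].
  case: ifP => [/tightP [sLU cL _ _]|_]; last by rewrite cards0.
  apply: leq_trans (leq_card_setU _ _) _.
  by have := card_late_bdry sLU cL; have := card_early_bdry sLU cL; nia.
have [tv vv ev] := LvP v L tL vb; have [tu uu eu] := LvP u L tL ub.
have [uU _ _] := bdryP _ _ ub.
(* If [u] is not to the right of [Lv v], then [Lv u], of size [l u], witnesses that [u] is late.
   Otherwise [L] itself, of size at most [l v], witnesses that [u] is early. *)
rewrite tv in_setU; case: (boolP (u \in Lv v :|: bdry (Lv v))) => uLb.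
  apply/orP; left; rewrite inE in_setD uY uLb; apply/existsP; exists (Lv u).
  by rewrite tu uu ev eu lvu.
apply/orP; right; rewrite inE right_notin // uLb; apply/existsP; exists L.
by rewrite tL ub ev /l (bigmax_sup L) // tL vb.
Qed.

(* A core vertex lies on no minimal separator of size at most c, so deleting it
   is harmless; a vertex outside the semicore dominates all but c vertices of Z. *)
Definition core c := [set v in U | [forall L, tight c L ==> (v \in L)]].
Definition semicore c := [set v in U | [forall L, tight c L ==> (v \in L :|: bdry L)]].

Lemma core_bdry c L v : tight c L -> v \in core c -> v \in L.
Proof. by move=> tL; rewrite inE => /andP [_ /forallP /(_ L)]; rewrite tL. Qed.

Lemma not_semicore c v : v \in U -> v \notin semicore c ->
  exists2 L, tight c L & v \in right L.
Proof.
move=> vU; rewrite inE vU /= => /forallPn [L]; rewrite negb_imply => /andP [tL vL].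
by exists L; rewrite // right_notin.
Qed.

(** For a smallest tight [L], a semicore vertex lies in [L :|: bdry L]. If it is not a core vertex
    it is on the boundary of some tight [L'], at least as large, so outside [Y] it belongs to
    [late_bdry c L]. *)
Lemma card_semicoreD c :
  #|(semicore c :\: core c) :\: Y| <= c + (3 * c + 1) * c.
Proof.
have [[L0 tL0]|no] := classic (exists L, tight c L); last first.
  rewrite [_ :\: core c](_ : _ = set0) ?set0D ?cards0 //.
  apply/eqP; rewrite setD_eq0; apply/subsetP => v; rewrite !inE => /andP [-> _].
  by apply/forallP => L; apply/implyP => tL; case: no; exists L.
case: (arg_minnP (fun L : {set T} => #|L|) tL0) => L tL minL.
have [sLU cL _ _] := tightP tL.
apply: leq_trans (card_late_bdry sLU cL); apply: subset_leq_card.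
apply/subsetP => v /setDP [/setDP [vs vc] vY].
have := vs; rewrite inE => /andP [vU /forallP hs].
move: vc; rewrite inE vU /= => /forallPn [L']; rewrite negb_imply => /andP [tL' vL'].
rewrite inE in_setD vY; have := hs L; rewrite tL /= => ->.
apply/existsP; exists L'; rewrite tL' minL //=.
by have := hs L'; rewrite tL' /= in_setU (negPf vL').
Qed.

End Separations.

(** * Greedy choice of sets under conflicts *)

(** An available option of least [l]-value is taken first; its vertices and its conflict set are
    then forbidden, at a cost of at most [m + q] per round. Later options were available before, so
    by minimality their values are no smaller, which is the order [conflict_bound] asks for. *)
Lemma greedy_choice (I T : finType) (Opt : I -> {set T} -> Prop) (N : {set T})
    (l : T -> nat) (Cf : T -> {set T}) m q s :
  (forall i O, Opt i O -> #|O| <= m /\ #|O :&: N| <= 1) ->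
  (forall v, #|Cf v| <= q) ->
  (forall i (F : {set T}), #|F| <= s -> exists O, Opt i O /\ [disjoint O & F]) ->
  forall (J : {set I}) (F : {set T}), #|F| + #|J| * (m + q) <= s ->
  exists O : I -> {set T},
    (forall i, i \in J -> Opt i (O i) /\ [disjoint O i & F]) /\
    forall i j, i \in J -> j \in J -> i != j -> [disjoint O i & O j] /\
      forall u v, u \in O i :&: N -> v \in O j :&: N ->
        (l v <= l u /\ u \notin Cf v) \/ (l u <= l v /\ v \notin Cf u).
Proof.
move=> optN cCf ex_opt J; have [n] := ubnP #|J|; elim: n J => // n IH J leJn F leF.
have [->|[i0 i0J]] := set_0Vmem J.
  by exists (fun=> set0); split=> [i|i j]; rewrite inE.
(* The maximum runs over at most one vertex; it is 0 when [O] misses [N]. *)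
pose lam (O : {set T}) := \max_(u in O :&: N) l u.
have lamE i O u : Opt i O -> u \in O :&: N -> lam O = l u.
  case/optN=> _ leON uON; rewrite /lam (big_pred1 u) // => v.
  exact: (card_le1P leON _ uON v).
pose P r := exists i O, [/\ i \in J, Opt i O, [disjoint O & F] & lam O = r].
have exP : exists r, P r.
  have [|O [oO dO]] := ex_opt i0 F; first by lia.
  by exists (lam O), i0, O.
have [r [i [O [iJ oO dO <-]]] minP] := ex_min_nat exP.
have [cO cON] := optN _ _ oO.
pose F' := F :|: O :|: \bigcup_(v in O :&: N) Cf v.
have cF' : #|F'| <= #|F| + (m + q).
  apply: leq_trans (leq_card_setU _ _) _.
  have h2 : #|\bigcup_(v in O :&: N) Cf v| <= q.
    apply: leq_trans (card_bigcup_le (fun v _ => cCf v)) _.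
    by rewrite -{2}[q]mul1n leq_mul2r cON orbT.
  apply: leq_trans (leq_add (leq_card_setU F O) h2) _.
  by rewrite -addnA leq_add2l leq_add2r.
have cJ : #|J| = #|J :\ i|.+1 by rewrite (cardsD1 i J) iJ.
have [||Os [optOs disjOs]] := IH (J :\ i) _ F'; [lia | nia |].
have dOs j : j \in J :\ i -> [/\ Opt j (Os j), [disjoint Os j & F], [disjoint Os j & O] &
    forall u v, u \in O :&: N -> v \in Os j :&: N -> l u <= l v /\ v \notin Cf u].
  move=> jJ; have [oj] := optOs j jJ.
  rewrite disjoint_sym /F' -setI_eq0 !setIUl !setU_eq0 !setI_eq0.
  case/andP => /andP [d1 d2] d3; split; rewrite 1?disjoint_sym // => u v uO vO.
  split.
    rewrite -(lamE _ _ _ oO uO) -(lamE _ _ _ oj vO); apply: minP.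
    exists j, (Os j); split=> //; last by rewrite disjoint_sym.
    by case/setD1P: jJ.
  have [vj _] := setIP vO; apply/negP => vC.
  by have := disjointFl d3 vj; move/negP; apply; apply/bigcupP; exists u.
exists (fun j => if j == i then O else Os j); split=> [j jJ|j j' jJ j'J].
  case: eqVneq => [->|nji] //; by have [|] := dOs j; first by apply/setD1P.
have [ji|nji] := eqVneq j i; have [j'i|nj'i] := eqVneq j' i => neq.
- by rewrite ji j'i eqxx in neq.
- have [|_ _ d h] := dOs j'; first by apply/setD1P.
  by rewrite disjoint_sym; split=> // u v uO vO; right; apply: h.
- have [|_ _ d h] := dOs j; first by apply/setD1P.
  by split=> // u v uO vO; left; apply: h.
- by apply: disjOs => //; apply/setD1P.
Qed.

(** * Reserved sets *)

(* After O is reserved, x still reaches Z through O whichever b vertices of Z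
   are taken later; at most one vertex of O can lie on a small separator. *)
Definition linker (T : finType) (a : rel T) (U Z Y : {set T}) c b x (O : {set T}) :=
  [/\ O \subset U, [disjoint O & Y :|: Z], #|O| <= 2 * (b + 1),
      #|O :&: ~: core a U Z Y c| <= 1 &
      forall Ban : {set T}, #|Ban| <= b -> exists p z,
        [/\ path a x (rcons p z), uniq p, {subset p <= O} & z \in Z :\: Ban]].

Lemma pick_outside (T : finType) (A B : {set T}) :
  #|B| < #|A| -> exists2 z, z \in A & z \notin B.
Proof.
move=> lt; have : ~~ (A \subset B) by apply/negP => /subset_leq_card; lia.
by case/subsetPn => z; exists z.
Qed.

(** Three cases. A usable out-neighbour of [x] outside the semicore suffices alone. So does a core
    out-neighbour followed by a vertex outside the semicore. Failing both, [access] leads from [x]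
    to each vertex of [Z] through at most two core vertices, and [b + 1] such routes are united. *)
Lemma linker_exists (T : finType) (a : rel T) (U Z Y F : {set T}) c b x :
  irreflexive a -> semicomplete a -> Z \subset U :\: Y ->
  (forall z v, z \in Z -> v \in (U :\: Y) :\: Z ->
     #|[set u in U | a u v]| <= #|[set u in U | a u z]|) ->
  c + b < #|Z| -> Y :|: Z \subset F ->
  3 * (#|F| + (c + (3 * c + 1) * c)) + 2 <= #|[set v in U | a x v]| ->
  exists O, linker a U Z Y c b x O /\ [disjoint O & F].
Proof.
move=> irr sc sZ topZ bigZ sYZF bigN.
set K := core a U Z Y c; set K' := semicore a U Z Y c.
have sKU : K \subset U by apply/subsetP => v; rewrite inE => /andP [].
have ZU z : z \in Z -> z \in U by move/(subsetP sZ) => /setDP [].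
(* A vertex to the right of a tight [L] dominates [L], which contains all of [Z] but at most [c]
   vertices; [b] more may be banned. *)
have escape g (Ban : {set T}) : g \in U -> g \notin K' -> #|Ban| <= b ->
    exists2 z, z \in Z :\: Ban & a g z.
  move=> gU gK' cBan; have [L tL gR] := not_semicore gU gK'.
  have [_ cL _ _] := tightP tL.
  have [|z zZ] := pick_outside (A := Z) (B := bdry a U Z L :|: Ban).
    by apply: leq_ltn_trans (leq_card_setU _ _) _; apply: leq_ltn_trans (leq_add cL cBan) bigZ.
  rewrite in_setU negb_or => /andP [zb zBan]; exists z; first by apply/setDP.
  apply: (right_dom sc _ gR); apply: contraNT zb => zL.
  by apply/bdryP; split; auto.
have dF (O : {set T}) : [disjoint O & F] -> [disjoint O & Y :|: Z].
  by apply: disjointWr.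
have [[h [hN hF hK']]|no1] :=
    classic (exists h, [/\ h \in [set v in U | a x v], h \notin F & h \notin K']).
  have [hU xh] : h \in U /\ a x h by move: hN; rewrite inE => /andP.
  have dh : [disjoint [set h] & F] by rewrite disjoints1.
  exists [set h]; split=> //; split=> [||||Ban cBan]; rewrite ?cards1 ?sub1set //; auto.
  - by rewrite muln_gt0 addn1.
  - by apply: leq_trans (subset_leq_card (subsetIl _ _)) _; rewrite cards1.
  have [z zZ hz] := escape h Ban hU hK' cBan.
  exists [:: h], z; split=> //=; first by rewrite xh hz.
  by move=> v; rewrite !inE.
have semi1 h : h \in U -> a x h -> h \notin F -> h \in K'.
  move=> hU xh hF; apply/negPn/negP => hK'; apply: no1; exists h; split=> //.
  by rewrite inE hU.
have [[h [g [[hU xh hF hK] [gU gF hg gK']]]]|no2] := classic (exists h g,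
    [/\ h \in U, a x h, h \notin F & h \in K] /\
    [/\ g \in U, g \notin F, a h g & g \notin K']).
  have dO : [disjoint [set h; g] & F].
    by rewrite -setI_eq0 setIUl setU_eq0 !setI_eq0 !disjoints1 hF.
  exists [set h; g]; split=> //; split=> [||||Ban cBan]; auto.
  - by rewrite subUset !sub1set hU.
  - by rewrite cards2 mulnDr; apply: leq_trans (leq_addl _ _); case: (h != g).
  - apply: leq_trans (_ : #|[set g]| <= _); last by rewrite cards1.
    apply: subset_leq_card; apply/subsetP => v; rewrite !in_setI !in_setU !in_set1 in_setC.
    by case/andP => /orP [/eqP ->|//]; rewrite hK.
  have [z zZ gz] := escape g Ban gU gK' cBan.
  exists [:: h; g], z; split=> //=; first by rewrite xh hg gz.
    by rewrite inE andbT; apply: contraTneq hg => ->; rewrite irr.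
  by move=> v; rewrite !inE.
(* Outside [F'] a semicore vertex is a core vertex, because [Y] is contained in [F]. *)
pose F' := (F :|: ((K' :\: K) :\: Y)) :&: U.
have cF' : #|F'| <= #|F| + (c + (3 * c + 1) * c).
  apply: leq_trans (subset_leq_card (subsetIl _ _)) _.
  apply: leq_trans (leq_card_setU _ _) _; rewrite leq_add2l.
  exact: card_semicoreD.
pose A := [set v in U | a x v] :\: F'.
have notF' v : v \in U -> v \notin F' -> [/\ v \notin F, v \notin Y, v \notin Z &
    v \in K' -> v \in K].
  move=> vU; rewrite in_setI vU andbT in_setU negb_or => /andP [vF vD].
  have : v \notin Y :|: Z by apply: contra vF; apply: (subsetP sYZF).
  rewrite in_setU negb_or => /andP [vY vZ]; split=> // vK'.
  by move: vD; rewrite in_setD vY /= in_setD vK' andbT negbK.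
have AP v : v \in A -> [/\ v \in U, a x v, v \notin F' & v \in K].
  case/setDP; rewrite inE => /andP [vU xv] vF'; split=> //.
  by have [vF _ _ h] := notF' v vU vF'; apply/h/semi1.
have bigA : 2 * #|F'| + 2 <= #|A|.
  have := cardsD [set v in U | a x v] F'; rewrite -/A => ->.
  by have := subset_leq_card (subsetIr [set v in U | a x v] F'); lia.
have /fin_all_exists [f fP] : forall z, exists O : {set T}, z \in Z ->
    [/\ O \subset K :\: F, #|O| <= 2 &
        exists p, [/\ path a x (rcons p z), uniq p & {subset p <= O}]].
  move=> z; case: (boolP (z \in Z)) => [zZ|_]; last by exists set0.
  have [|||v vA|||v vA [vz|[w [/setDP [wU wF'] vw wz]]]] :=
      access (A := A) (F := F') (U := U) (z := z) (s := #|F'|) irr sc.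
  - by apply/subsetP => v /AP [].
  - exact: subsetIr.
  - by rewrite disjoints_subset /A setDE subsetIr.
  - by apply: subset_leq_card; apply/subsetP => u; rewrite inE => /andP [].
  - move=> v /AP [vU xv vF' vK]; apply: topZ => //.
    by have [_ vY vZ _] := notF' v vU vF'; rewrite !in_setD vY vZ.
  - exact: bigA.
  - have [vU xv vF' vK] := AP v vA; have [vF _ _ _] := notF' v vU vF'.
    exists [set v] => _; rewrite cards1 sub1set in_setD vF vK; split=> //.
    exists [:: v]; split=> //=; first by rewrite xv vz.
    by move=> u; rewrite !inE.
  have [vU xv vF' vK] := AP v vA; have [vF _ _ _] := notF' v vU vF'.
  have [wF _ _ wK] := notF' w wU wF'.
  have {}wK : w \in K.
    apply: wK; apply/negPn/negP => wK'; apply: no2; exists v, w; by split.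
  exists [set v; w] => _; rewrite cards2 subUset !sub1set !in_setD vF vK wF wK.
  split=> //; first by case: (v != w).
  exists [:: v; w]; split=> //=; first by rewrite xv vw wz.
    by rewrite inE andbT; apply: contraTneq vw => ->; rewrite irr.
  by move=> u; rewrite !inE.
have [|Z1 [sZ1 cZ1 _]] := top_set (V := Z) (m := b + 1) (fun=> 0).
  by rewrite addn1; apply: leq_ltn_trans bigZ; apply: leq_addl.
pose O := \bigcup_(z in Z1) f z.
have sO : O \subset K :\: F.
  by apply/bigcupsP => z zZ1; have [] := fP z (subsetP sZ1 z zZ1).
have [sOK dOF] : O \subset K /\ [disjoint O & F].
  by move: sO; rewrite subsetD => /andP.
exists O; split=> //; split; auto.
- exact: subset_trans sOK sKU.
- rewrite mulnC -cZ1; apply: card_bigcup_le => z zZ1.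
  by have [] := fP z (subsetP sZ1 z zZ1).
- by rewrite -setDE (eqP (_ : O :\: K == set0)) ?cards0 // setD_eq0.
move=> Ban cBan; have [|z zZ1 zB] := pick_outside (A := Z1) (B := Ban).
  by rewrite cZ1 addn1.
have zZ := subsetP sZ1 z zZ1; have [_ _ [p [pp up sp]]] := fP z zZ.
exists p, z; split=> //; last by apply/setDP.
by move=> v /sp vf; apply/bigcupP; exists z.
Qed.

(** * The cut condition off the reserved sets *)

Definition arcs_in (T : finType) (a : rel T) (V : {set T}) : {set T * T} :=
  [set e | [&& e.1 \in V, e.2 \in V & a e.1 e.2]].

Lemma arc_arcs_in (T : finType) (a : rel T) V u v :
  arc_rel (arcs_in a V) u v = [&& u \in V, v \in V & a u v].
Proof. by rewrite /arc_rel inE. Qed.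

(** Take [L] of maximal size with boundary in [S]. Adding to it a boundary vertex [u] outside [Y]
    must create a boundary vertex outside [S], and this is an out-neighbour of [u] in [right L]. *)
Lemma tight_of_max (T : finType) (a : rel T) (U Z Y S L0 : {set T}) :
  L0 \subset U :\: Y -> bdry a U Z L0 \subset S ->
  exists2 L, bdry a U Z L \subset S & tight a U Z Y #|S| L.
Proof.
move=> sL0 bL0.
pose P (L : {set T}) := (L \subset U :\: Y) && (bdry a U Z L \subset S).
have P0 : P L0 by rewrite /P sL0.
case: (arg_maxnP (fun L : {set T} => #|L|) P0) => L /andP [sL bL] maxL.
exists L => //; apply/and3P; split=> //; first exact: subset_leq_card.
apply/forallP => u; apply/implyP => /setDP [ub uY]; have [uU uL _] := bdryP _ _ _ _ _ ub.
have : ~~ P (u |: L).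
  by apply/negP => /maxL; rewrite cardsU1 uL; lia.
rewrite /P subUset sub1set sL in_setD uU uY /= => /subsetPn [w].
case/bdryP => wU; rewrite in_setU1 negb_or => /andP [wu wL] hw wS.
have wb : w \notin bdry a U Z L by apply: contra wS; apply: (subsetP bL).
apply/existsP; exists w; apply/andP; split; first by apply/rightP.
case: hw => [wZ|[l /setU1P [->//|lL] lw]].
  by case/negP: wb; apply/bdryP; split; auto.
by rewrite (bdry_arc Z wU wL lL lw) in wb.
Qed.

Lemma path_closed (T : finType) (a : rel T) (L : {set T}) (P : pred T) u p :
  (forall v w, v \in L -> P w -> a v w -> w \in L) ->
  path a u p -> all P p -> u \in L -> last u p \in L.
Proof.
move=> cl; elim: p u => //= w p IH u /andP [uw pw] /andP [Pw Pp] uL.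
by apply: IH => //; apply: cl uw.
Qed.

(* A maximal L with boundary inside the offending cut is tight; its boundary
   avoids the core and contains at most one reserved vertex, hence has at most
   k elements, contradicting connectivity. *)
Lemma linkers_cut (T : finType) (a : rel T) (k : nat) (U Z Y : {set T})
    (O : 'I_k -> {set T}) c :
  Z \subset U :\: Y -> Y \subset U -> #|Y| = k -> k < #|Z| ->
  (forall (S : {set T}) z y, #|S| <= k -> z \in U :\: S -> y \in U :\: S -> z != y ->
     exists p, [/\ path a z p, last z p = y & {subset p <= U :\: S}]) ->
  (forall i, [/\ O i \subset U, [disjoint O i & Y :|: Z] &
     #|O i :&: ~: core a U Z Y c| <= 1]) ->
  (forall i j u v L, i != j -> u \in O i :&: ~: core a U Z Y c ->
     v \in O j :&: ~: core a U Z Y c -> tight a U Z Y (2 * k) L ->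
     u \in bdry a U Z L -> v \in bdry a U Z L -> False) ->
  k + #|\bigcup_i O i| <= c ->
  forall L : {set T}, [disjoint L & Y] ->
    k <= #|out_bd (arcs_in a (U :\: \bigcup_i O i)) Z L|.
Proof.
move=> sZ sY cY bigZ conn optO confO cO L dLY.
set OO := \bigcup_i O i in cO *; set E := arcs_in _ _; set S0 := out_bd E Z L.
rewrite leqNgt; apply/negP => ltS0.
have OOY u : u \in OO -> u \notin Y.
  case/bigcupP => i _ ui; have [_ dO _] := optO i.
  by have := disjointFr dO ui; rewrite in_setU => /negbT; rewrite negb_or => /andP [].
have [||M bM tM] := @tight_of_max _ a U Z Y (S0 :|: OO) ((L :&: U) :\: OO).
- apply/subsetP => u /setDP [/setIP [uL uU] _]; rewrite in_setD uU andbT.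
  by rewrite (disjointFr dLY uL).
- apply/subsetP => u /bdryP [uU]; rewrite in_setD in_setI uU andbT in_setU.
  case: (boolP (u \in OO)) => [_ _ _|uO /= uL]; first by rewrite orbT.
  case=> [uZ|[l /setDP [/setIP [lL lU] lO] lu]]; rewrite orbF.
    exact: out_bd_start.
  apply: (out_bd_arc _ lL) => //; rewrite arc_arcs_in !in_setD lO lU uO uU.
  exact: lu.
have [sMU cM dMY _] := tightP tM.
have cS : #|S0 :|: OO| <= c by apply: leq_trans (leq_card_setU _ _) _; lia.
have tMc : tight a U Z Y c M by apply: tight_leq tM (leq_trans cM cS).
set K := core a U Z Y c in optO confO.
have bK u : u \in bdry a U Z M -> u \notin K.
  by move=> /bdryP [_ uM _]; apply: contra uM => /(core_bdry tMc).
have cb : #|bdry a U Z M| <= #|S0| + #|bdry a U Z M :&: OO|.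
  apply: leq_trans (leq_card_setU _ _); apply: subset_leq_card.
  apply/subsetP => u ub; rewrite in_setU in_setI ub /=.
  by have := subsetP bM u ub; rewrite in_setU.
(* The bound improves in stages: the crude bound [c] makes the boundary avoid the core, so each
   [O i] contributes at most one vertex and [2 * k] suffices; only then do the conflicts apply and
   leave one reserved vertex. *)
have tM2 : tight a U Z Y (2 * k) M.
  apply: tight_leq tM _; apply: leq_trans cb _.
  have : #|bdry a U Z M :&: OO| <= k * 1.
    rewrite -[k in k * 1]card_ord -cardsT.
    apply: leq_trans (card_bigcup_le (F := fun i => O i :&: ~: K) (c := 1) _).
      apply: subset_leq_card; apply/subsetP => u /setIP [ub /bigcupP [i _ ui]].
      by apply/bigcupP; exists i; [by rewrite inE | by rewrite in_setI ui in_setC bK].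
    by move=> i _; have [] := optO i.
  by lia.
have c1 : #|bdry a U Z M :&: OO| <= 1.
  apply/card_le1_eqP => u v /setIP [ub /bigcupP [i _ ui]] /setIP [vb /bigcupP [j _ vj]].
  have uK : u \in O i :&: ~: K by rewrite in_setI ui in_setC bK.
  have vK : v \in O j :&: ~: K by rewrite in_setI vj in_setC bK.
  have [ij|nij] := eqVneq i j; last by case: (confO i j u v M).
  have [_ _ h] := optO j; rewrite ij in uK.
  exact: (card_le1_eqP h).
have cbk : #|bdry a U Z M| <= k.
  by apply: leq_trans cb (leq_trans (leq_add (leqnn _) c1) _); rewrite addn1.
have [y yY yb] : exists2 y, y \in Y & y \notin bdry a U Z M.
  have [|y yY yS] := @pick_outside _ Y S0; first by rewrite cY.
  exists y => //; apply: contra yS => /(subsetP bM); rewrite in_setU.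
  by case/orP => // /OOY; rewrite yY.
have [|z zZ zb] := @pick_outside _ Z (bdry a U Z M).
  exact: leq_ltn_trans cbk bigZ.
have /setDP [zU zY] := subsetP sZ z zZ.
have zM : z \in M.
  by apply: contraNT zb => zM; apply/bdryP; split; auto.
have yM : y \notin M by apply/negP => yM; have := disjointFr dMY yM; rewrite yY.
have [|||p [pp lp sp]] := conn (bdry a U Z M) z y cbk.
- by apply/setDP.
- by apply/setDP; split=> //; apply: (subsetP sY).
- by apply: contraNneq yM => <-.
case/negP: yM; rewrite -lp.
apply: (path_closed (P := mem (U :\: bdry a U Z M)) _ pp) => // [v w vM|].
  case/setDP => wU wb vw; apply: contraNT wb => wM.
  exact: (bdry_arc Z wU wM vM vw).
by apply/allP => v /sp.
Qed.

(** * Shortest linkages *)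

Section ShortestLinkage.
Variables (T : finType) (a : rel T) (V Z : {set T}) (k : nat) (ys : 'I_k -> T).
Hypothesis sZV : Z \subset V.

Definition linkage_to (s : 'I_k -> T) (p : 'I_k -> seq T) :=
  path_family [set: 'I_k] (arcs_in a V) Z [set ys i | i : 'I_k] s p /\
  forall i, last (s i) (p i) = ys i.

(** The ends are prescribed, but the starts may be any vertices of [Z]; this freedom is what the
    shortcut arguments use. *)
Definition shortest_linkage s p :=
  linkage_to s p /\
  forall s' p', linkage_to s' p' -> \sum_i size (p i) <= \sum_i size (p' i).

Lemma shortest_linkage_exists : injective ys ->
  (forall L : {set T}, [disjoint L & [set ys i | i : 'I_k]] ->
     k <= #|out_bd (arcs_in a V) Z L|) ->
  exists s p, shortest_linkage s p.
Proof.
move=> ys_inj cut; have cY : #|[set ys i | i : 'I_k]| = k.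
  by rewrite card_imset // card_ord.
have [J [s [p [cJ pf]]]] := menger cut.
have [|s' [p' [pf' last']]] := path_family_by_last pf; first by rewrite cY cJ.
pose P n := exists s p, linkage_to s p /\ \sum_i size (p i) = n.
have exP : exists n, P n.
  exists (\sum_i size ((p' \o ys) i)), (s' \o ys), (p' \o ys); split=> //.
  split=> [|i]; last by apply: last'; apply: imset_f.
  by apply: path_family_reindex pf' _ (in2W ys_inj) => i _; apply: imset_f.
have [n [s0 [p0 [l0 <-]]] minP] := ex_min_nat exP.
by exists s0, p0; split=> // s1 p1 l1; apply: minP; exists s1, p1.
Qed.

Lemma arcs_in_sub u p : u \in V -> path (arc_rel (arcs_in a V)) u p ->
  {subset u :: p <= V}.
Proof.
elim: p u => [|w p IH] u uV /=; first by move=> _ v; rewrite inE => /eqP ->.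
rewrite {1}arc_arcs_in => /andP [/and3P [_ wV _] pw] v.
by rewrite inE => /predU1P [-> //|]; apply: IH.
Qed.

Variables (s : 'I_k -> T) (p : 'I_k -> seq T).
Hypothesis sp_min : shortest_linkage s p.

Definition linkage_verts := [set v | [exists i, v \in s i :: p i]].
Notation R := linkage_verts.

Lemma linkage_vertsP v : reflect (exists i, v \in s i :: p i) (v \in R).
Proof. by rewrite inE; apply: existsP. Qed.

Lemma linkage_verts_sub : R \subset V.
Proof.
apply/subsetP => v /linkage_vertsP [i vi]; have [[pf _] _] := sp_min.
apply: (arcs_in_sub _ (pf_path pf (in_setT i)) vi).
by apply/(subsetP sZV)/(pf_start pf); rewrite inE.
Qed.

Lemma shortest_replace j u q : u \in Z -> path (arc_rel (arcs_in a V)) u q ->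
  last u q = ys j -> uniq (u :: q) ->
  (forall i v, i != j -> v \in u :: q -> v \notin s i :: p i) ->
  size (p j) <= size q.
Proof.
move=> uZ pq lq uq dq; have [[pf lp] minp] := sp_min.
have := minp (fun i => if i == j then u else s i) (fun i => if i == j then q else p i).
have -> : \sum_i size (if i == j then q else p i) =
    size q + \sum_(i | i != j) size (p i).
  by rewrite (bigD1 j) //= eqxx; congr addn; apply: eq_bigr => i /negPf ->.
rewrite (bigD1 j) //= leq_add2r; apply; split; last by move=> i; case: eqVneq => [->|].
split=> [i _|i _|i _|i _|i i' v _ _].
- by case: eqVneq => // _; apply: (pf_start pf); rewrite inE.
- by case: eqVneq => // _; apply: (pf_path pf); rewrite inE.
- by case: eqVneq => [_|_]; rewrite ?lq ?lp; apply: imset_f.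
- by case: eqVneq => // _; apply: (pf_uniq pf); rewrite inE.
case: (eqVneq i j) => [->|ni]; case: (eqVneq i' j) => [->|ni'] //.
- by move=> vq vi'; have := dq i' v ni' vq; rewrite vi'.
- by move=> vi vq; have := dq i v ni vq; rewrite vi.
by apply: (pf_disj pf); rewrite inE.
Qed.

Lemma linkage_split j v : v \in s j :: p j ->
  exists q1 q2, [/\ s j :: p j = q1 ++ v :: q2, path (arc_rel (arcs_in a V)) v q2,
    last v q2 = ys j, uniq (v :: q2) &
    forall i w, i != j -> w \in v :: q2 -> w \notin s i :: p i].
Proof.
have [[pf lp] _] := sp_min => vj.
have [q1 [q2 e]] : exists q1 q2, s j :: p j = q1 ++ v :: q2.
  by case/splitPr: vj => q1 q2; exists q1, q2.
exists q1, q2; split=> //.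
- have : sorted (arc_rel (arcs_in a V)) (s j :: p j).
    by apply: (pf_path pf); rewrite inE.
  by rewrite e => /cat_sorted2 [].
- by rewrite -(lp j) -[RHS](last_cons v) e last_cat.
- by have := pf_uniq pf (in_setT j); rewrite e cat_uniq => /and3P [].
move=> i w nij wq; apply/negP => wi; case/negP: nij; apply/eqP.
apply: (pf_disj pf (in_setT i) (in_setT j) wi).
by rewrite e mem_cat wq orbT.
Qed.

(** A path meeting [Z] again could be started there and would be shorter. *)
Lemma linkage_start j z : z \in Z -> z \in s j :: p j -> z = s j.
Proof.
move=> zZ /linkage_split [q1 [q2 [e pq lq uq dq]]].
have := shortest_replace zZ pq lq uq dq.
have := congr1 size e; rewrite size_cat /=; case: q1 e => [[->//]|w q1 _] /=.
by clear; lia.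
Qed.

(** Entering path [j] at [v] by way of [z] and [m] gives a competing linkage, so at most
    [size m + 1] vertices of path [j] precede [v]. *)
Lemma linkage_shortcut j z m v n : z \in Z -> path a z (rcons m v) ->
  uniq (z :: m) -> {subset z :: m <= V :\: R} -> v \in s j :: p j ->
  size m + 2 <= n -> v \in take n (s j :: p j).
Proof.
move=> zZ pm um sm vj len; have [q1 [q2 [e pq lq uq dq]]] := linkage_split vj.
have vV : v \in V.
  by apply: (subsetP linkage_verts_sub); apply/linkage_vertsP; exists j.
have notR w i : w \in z :: m -> w \notin s i :: p i.
  by move=> /sm /setDP [_]; apply: contra => wi; apply/linkage_vertsP; exists i.
have q2j w : w \in v :: q2 -> w \in s j :: p j by move=> wq; rewrite e mem_cat wq orbT.
have pE : path (arc_rel (arcs_in a V)) z (rcons m v).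
  have : all (mem V) (z :: rcons m v).
    apply/allP => w; rewrite -rcons_cons mem_rcons inE.
    by case/predU1P => [-> //|/sm /setDP []].
  elim: (rcons m v) (z) pm => //= w q IH u /andP [uw pw] /and3P [uV wV qV].
  by rewrite arc_arcs_in uV wV uw IH //= wV.
have h : size (p j) <= size (m ++ v :: q2).
  apply: (shortest_replace zZ).
  - by rewrite -cat_rcons cat_path pE last_rcons.
  - by rewrite last_cat /= lq.
  - rewrite -cat_cons cat_uniq um uq andbT; apply/hasPn => w wq.
    by apply/negP => wm; have := notR w j wm; rewrite q2j.
  move=> i w nij; rewrite -cat_cons mem_cat => /orP [wm|wq]; first exact: notR.
  exact: dq nij wq.
have lt_n : size q1 < n.
  have e1 : (size (p j)).+1 = size q1 + (size q2).+1.
    by rewrite -[LHS]/(size (s j :: p j)) e size_cat.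
  by move: h; rewrite -ltnS e1 size_cat /=; lia.
rewrite e take_cat ltnNge (ltnW lt_n) /= mem_cat; apply/orP; right.
by have := lt_n; rewrite -subn_gt0; case: (n - size q1) => //= r _; rewrite mem_head.
Qed.

End ShortestLinkage.

(** * Connecting the reserved sets to the linkage *)

(** The route goes through [Oi] to a vertex [z] of [Z] off the linkage, on to an out-neighbour of
    [z], and from there by [access] to [s i]. The set [Us] holds the vertices taken by other
    connections. *)
Lemma connect_to_linkage (T : finType) (a : rel T) (U Z OO Oi Us : {set T}) k
    (ys s : 'I_k -> T) p c b x i D :
  let Y := [set ys i | i : 'I_k] in let R := linkage_verts s p in
  irreflexive a -> semicomplete a -> Z \subset U :\: Y ->
  (forall z v, z \in Z -> v \in (U :\: Y) :\: Z ->
     #|[set u in U | a u v]| <= #|[set u in U | a u z]|) ->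
  [disjoint OO & Z] -> shortest_linkage a (U :\: OO) Z ys s p ->
  linker a U Z Y c b x Oi -> Oi \subset OO -> k + #|Us| <= b ->
  (forall v, D <= #|[set w in U | a v w]|) ->
  3 * (3 * k + #|OO| + #|Z| + #|Us|) + 2 <= D ->
  exists q (M : {set T}), [/\ path a x (rcons q (s i)), uniq q,
    {in q, forall v, v \in Oi \/ v \in M},
    M \subset U :\: (R :|: OO) & #|M| <= 3 /\ [disjoint M & Us]].
Proof.
move=> Y R irr sc sZ topZ dOZ sp_min [_ _ _ _ link] sOi leb degD bigD.
have sZV : Z \subset U :\: OO.
  apply/subsetP => z zZ; have /setDP [zU _] := subsetP sZ z zZ.
  by rewrite in_setD zU (disjointFl dOZ zZ).
have [[pf lastp] _] := sp_min.
have cRZ : #|R :&: Z| <= k.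
  apply: leq_trans (_ : #|s @: [set: 'I_k]| <= k); last first.
    by apply: leq_trans (leq_imset_card _ _) _; rewrite cardsT card_ord.
  apply: subset_leq_card; apply/subsetP => z /setIP [/linkage_vertsP [j zj] zZ].
  by rewrite (linkage_start sp_min zZ zj) imset_f.
(* The linkage meets [Z] only in its [k] starts, so at most [k + #|Us|] vertices are banned. *)
have [|q1 [z [pz uq1 sq1 /setDP [zZ zBan]]]] := link ((R :&: Z) :|: Us).
  by apply: leq_trans (leq_card_setU _ _) _; lia.
have [zR zUs] : z \notin R /\ z \notin Us.
  by move: zBan; rewrite in_setU in_setI zZ andbT negb_or => /andP.
have /setDP [zU zY] := subsetP sZ z zZ.
have zO : z \notin OO by rewrite (disjointFl dOZ zZ).
(* By [linkage_shortcut], a walk of one or two arcs from [z] can enter a linkage path only among its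
   first three vertices. *)
pose T3 := \bigcup_(j : 'I_k) [set v in take 3 (s j :: p j)].
have cT3 : #|T3| <= 3 * k.
  rewrite mulnC -[k in k * 3]card_ord -cardsT.
  apply: leq_trans (card_bigcup_le (F := fun j => [set v in take 3 (s j :: p j)]) (c := 3) _).
    by apply: subset_leq_card; apply/bigcupsP => j _; apply: (bigcup_sup j); rewrite ?inE.
  move=> j _; rewrite cardsE; apply: leq_trans (card_size _) _.
  by rewrite size_take; case: ltnP.
have inT3 j v : v \in take 3 (s j :: p j) -> v \in T3.
  by move=> vj; apply/bigcupP; exists j; rewrite // inE.
pose B := OO :|: Z :|: Us.
have cB : #|B| <= #|OO| + #|Z| + #|Us|.
  apply: leq_trans (leq_card_setU _ _) _; rewrite leq_add2r; exact: leq_card_setU.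
pose F := (R :|: B) :&: U.
pose A := [set v in U | a z v] :\: F.
have AP v : v \in A -> [/\ v \in U, a z v, v \notin R & v \notin B].
  case/setDP; rewrite inE => /andP [vU zv]; rewrite in_setI vU andbT in_setU negb_or.
  by case/andP.
have YR y : y \in Y -> y \in R.
  by case/imsetP => j _ ->; apply/linkage_vertsP; exists j; rewrite -lastp mem_last.
have BP v : v \notin B -> [/\ v \notin OO, v \notin Z & v \notin Us].
  by rewrite !in_setU !negb_or => /andP [/andP []].
have zV : z \in (U :\: OO) :\: R by rewrite !in_setD zR zO zU.
have sA : [set v in U | a z v] \subset A :|: (T3 :|: B).
  apply/subsetP => v vN; rewrite in_setU in_setD vN andbT.
  case: (boolP (v \in F)) => //= /setIP [/setUP [vR|vB] vU]; last first.
    by rewrite in_setU vB orbT.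
  have [j vj] := linkage_vertsP _ _ _ vR.
  have zv : a z v by move: vN; rewrite inE => /andP [].
  rewrite in_setU (inT3 j) //.
  apply: (linkage_shortcut sZV sp_min (z := z) (m := [::])) => //=.
    by rewrite zv.
  by move=> w; rewrite inE => /eqP ->.
pose N := 3 * k + (#|OO| + #|Z| + #|Us|).
have cTB : #|T3 :|: B| <= N.
  by apply: leq_trans (leq_card_setU _ _) (leq_add cT3 cB).
have cA : D <= #|A| + N.
  apply: leq_trans (degD z) _; apply: leq_trans (subset_leq_card sA) _.
  by apply: leq_trans (leq_card_setU _ _) _; rewrite leq_add2l.
(* A vertex [v] of [A] sends arcs into the linkage only inside [T3], so by semicompleteness all of
   [F] outside [T3 :|: B] dominates [v]. The target [s i] is in [Z], hence of in-degree at least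
   that of [v]. *)
have [||||||v vA hv] :=
    access (A := A) (F := F) (U := U) (z := s i) (s := #|T3 :|: B|) irr sc.
- by apply/subsetP => v /AP [].
- exact: subsetIr.
- by rewrite disjoints_subset /A setDE subsetIr.
- move=> v vA; have [vU zv vR vB] := AP v vA; have [vO vZ vUs] := BP v vB.
  apply: subset_leq_card; apply/subsetP => u; rewrite inE.
  case/andP => /setIP [/setUP [uR|uB] _] nuv; rewrite in_setU; last by rewrite uB orbT.
  have nvu : v != u by apply: contraNneq vR => ->.
  have vu : a v u by have := sc _ _ nvu; rewrite (negPf nuv) orbF.
  have [j uj] := linkage_vertsP _ _ _ uR; rewrite (inT3 j) //.
  apply: (linkage_shortcut sZV sp_min (z := z) (m := [:: v])) => //=.
  + by rewrite zv vu.
  + by rewrite inE andbT; apply: contraTneq zv => ->; rewrite irr.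
  move=> w; rewrite in_cons mem_seq1 => /orP [] /eqP -> //.
  by apply/setDP; split=> //; apply/setDP.
- move=> v vA; have [vU zv vR vB] := AP v vA; have [vO vZ vUs] := BP v vB.
  apply: topZ; first by apply: (pf_start pf); rewrite inE.
  by rewrite !in_setD vZ vU andbT; apply: contra vR; apply: YR.
- apply: leq_trans (_ : 2 * N + 2 <= _); first by rewrite leq_add2r leq_mul2l cTB.
  rewrite -(leq_add2r N); apply: leq_trans cA; apply: leq_trans bigD.
  by rewrite addnAC -mulSnr leq_add2r leq_mul2l /N !addnA leqnn orbT.
have [vU zv vR vB] := AP v vA; have [vO vZ vUs] := BP v vB.
have q1O w : w \in q1 -> w \in OO by move/sq1/(subsetP sOi).
have via m : path a z (rcons m (s i)) -> uniq (z :: m) -> size m <= 2 ->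
    {in z :: m, forall w, [/\ w \in U, w \notin R, w \notin OO & w \notin Us]} ->
    exists q (M : {set T}), [/\ path a x (rcons q (s i)), uniq q,
      {in q, forall v, v \in Oi \/ v \in M},
      M \subset U :\: (R :|: OO) & #|M| <= 3 /\ [disjoint M & Us]].
  move=> pm um cm mP; exists (q1 ++ z :: m), [set w in z :: m]; split.
  - by rewrite -cat_rcons rcons_cat cat_path pz last_rcons.
  - rewrite cat_uniq uq1 um andbT; apply/hasPn => w /mP [_ _ wO _].
    by apply: contra wO => /q1O.
  - move=> w; rewrite mem_cat => /orP [/sq1|wm]; first by left.
    by right; rewrite inE.
  - apply/subsetP => w; rewrite inE => /mP [wU wR wO _].
    by rewrite in_setD in_setU negb_or wR wO.
  split; first by rewrite cardsE; apply: leq_trans (card_size _) _.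
  rewrite -setI_eq0; apply/eqP/setP => w; rewrite in_setI !inE.
  by apply/andP => -[] /mP [_ _ _ wUs]; apply/negP.
have zv_neq : z != v by apply: contraTneq zv => ->; rewrite irr.
case: hv => [vs|[w [/setDP [wU wF] vw ws]]].
  apply: (via [:: v]) => //=; first by rewrite zv vs.
    by rewrite inE andbT.
  by move=> u; rewrite in_cons mem_seq1 => /orP [] /eqP ->.
have [wR /BP [wO wZ wUs]] : w \notin R /\ w \notin B.
  by move: wF; rewrite in_setI wU andbT in_setU negb_or => /andP.
apply: (via [:: v; w]) => //=; first by rewrite zv vw ws.
  rewrite !inE negb_or zv_neq andbT /=; apply/andP; split.
    by apply: contraNneq wZ => <-.
  by apply: contraTneq vw => ->; rewrite irr.
by move=> u; rewrite !in_cons in_nil orbF => /or3P [] /eqP ->.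
Qed.

(** * The linkage *)

(** With [c = 11 * k ^ 2], [b = 4 * k] and [#|Z| = 16 * k ^ 2], these say in order: [c + b < #|Z|];
    the reserved sets and [k] more vertices number at most [c]; the out-degree suffices for choosing
    the reserved sets; it suffices for the connections; [U :\: Y] has room for [Z]. In the last
    three, [2 * k] leaves room for discarding [X] and [Y]. *)
Lemma main_arith k : 0 < k ->
  [/\ 11 * k ^ 2 + 4 * k < 16 * k ^ 2,
      k + k * (2 * (4 * k + 1)) <= 11 * k ^ 2,
      3 * (k * (2 * (4 * k + 1) + (13 * (2 * k) ^ 2 + 4 * (2 * k))) +
           (k + 16 * k ^ 2) +
           (11 * k ^ 2 + (3 * (11 * k ^ 2) + 1) * (11 * k ^ 2))) + 2 + 2 * k
        <= 10 ^ 7 * k ^ 4,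
      3 * (3 * k + k * (2 * (4 * k + 1)) + 16 * k ^ 2 + 3 * k) + 2 + 2 * k
        <= 10 ^ 7 * k ^ 4 &
      16 * k ^ 2 + 2 * k <= 10 ^ 7 * k ^ 4].
Proof.
move=> k_gt0.
have h1 : k <= k ^ 2 by rewrite -{1}[k]expn1 leq_pexp2l.
have h2 : k ^ 2 <= k ^ 3 by rewrite leq_pexp2l.
have h3 : k ^ 3 <= k ^ 4 by rewrite leq_pexp2l.
by split; nia.
Qed.

(** Being [(2k+1)]-connected, the digraph tolerates the deletion of [X] together with [k] further
    vertices. *)
Lemma dpath_connected (T : finType) (a : rel T) k (X : {set T}) :
  k_connected a (2 * k + 1) -> #|X| <= k ->
  forall (S : {set T}) z y, #|S| <= k -> z \in ~: X :\: S -> y \in ~: X :\: S ->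
    z != y -> exists p, [/\ path a z p, last z p = y & {subset p <= ~: X :\: S}].
Proof.
move=> [_ conn] cX S z y cS; rewrite !in_setD !in_setC => /andP [zS zX] /andP [yS yX] neq.
have [||||p] := conn (X :|: S) z y; rewrite ?in_setU ?negb_or ?zX ?yX //.
  by rewrite addn1 /= mul2n -addnn; apply: leq_trans (leq_card_setU _ _) (leq_add cX cS).
case/andP => /and3P [pp /eqP lp _] dp; exists p; split=> // v vp.
have := disjointFr dp (_ : v \in z :: p); rewrite in_cons vp orbT => /(_ isT) /negbT.
by rewrite in_setU negb_or in_setD in_setC andbC.
Qed.

Theorem theorem3 (k : nat) (T : finType) (a : rel T) :
  0 < k -> simple_digraph a -> semicomplete a ->
  k_connected a (2 * k + 1) ->
  min_outdeg_ge a (10 ^ 7 * k ^ 4) ->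
  k_linked a k.
Proof.
move=> k_gt0 irr sc conn mindeg xs ys xs_inj ys_inj xy_neq.
have [ar1 ar2 ar3 ar4 ar5] := main_arith k_gt0.
(* The degree bound becomes a variable, which keeps the numeral [10 ^ 7] out of later
   computations. *)
move: mindeg ar3 ar4 ar5; move: (10 ^ 7 * k ^ 4) => d mindeg ar3 ar4 ar5.
set X := [set xs i | i : 'I_k]; set Y := [set ys i | i : 'I_k].
have cX : #|X| = k by rewrite card_imset // card_ord.
have cY : #|Y| = k by rewrite card_imset // card_ord.
pose U := ~: X; pose indeg v := #|[set u in U | a u v]|.
have subk n : n + 2 * k <= d -> n <= d - k by clear; lia.
have sYU : Y \subset U.
  apply/subsetP => _ /imsetP [j _ ->]; rewrite in_setC; apply/imsetP => -[i _ e].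
  by have := xy_neq i j; rewrite e eqxx.
have degU v : d - k <= #|[set w in U | a v w]|.
  have -> : [set w in U | a v w] = [set w | a v w] :\: X.
    by apply/setP => w; rewrite [in LHS]inE [in RHS]in_setD !inE.
  rewrite cardsD leq_sub ?mindeg // -cX; exact: subset_leq_card (subsetIr _ _).
have cUY : 16 * k ^ 2 <= #|U :\: Y|.
  have := degU (xs (Ordinal k_gt0)); have := cardsID Y U; rewrite (setIidPr sYU) cY.
  have : #|[set w in U | a (xs (Ordinal k_gt0)) w]| <= #|U|.
    by apply: subset_leq_card; apply/subsetP => w; rewrite inE => /andP [].
  by lia.
have [Z [sZ cZ topZ]] := top_set indeg cUY.
(* The value of [b] is [k + 3 * k]: the [k] starts in [Z], and three vertices for each of the [k]
   connections. A reserved set has at most [m] vertices. *)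
pose c := 11 * k ^ 2; pose b := 4 * k; pose m := 2 * (b + 1).
pose q := 13 * (2 * k) ^ 2 + 4 * (2 * k).
have [l [Cf [cCf confl]]] := conflict_bound U Z Y sc (2 * k).
have [|||O [linkO confO]] := @greedy_choice 'I_k T (fun i => linker a U Z Y c b (xs i))
    (~: core a U Z Y c) l Cf m q (k * (m + q)) _ cCf _ [set: 'I_k] set0.
- by move=> i O [].
- move=> i F cF.
  have [|||O [lO dO]] := @linker_exists _ a U Z Y (F :|: (Y :|: Z)) c b (xs i) irr sc sZ topZ.
  + by rewrite cZ.
  + exact: subsetUr.
  + apply: leq_trans (degU _); apply: leq_trans (subk _ ar3).
    rewrite leq_add2r leq_mul2l leq_add2r; apply: leq_trans (leq_card_setU _ _) _.
    by apply: leq_add cF _; apply: leq_trans (leq_card_setU _ _) _; rewrite cY cZ.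
  by exists O; split=> //; apply: disjointWr dO; apply: subsetUl.
- by rewrite cards0 cardsT card_ord.
pose OO := \bigcup_i O i.
have lO i : linker a U Z Y c b (xs i) (O i) by have [] := linkO i (in_setT i).
have cOO : #|OO| <= k * m.
  rewrite -[k in k * m]card_ord -cardsT.
  apply: leq_trans (card_bigcup_le (F := O) (c := m) _).
    by apply: subset_leq_card; apply/bigcupsP => i _; apply: (bigcup_sup i); rewrite ?inE.
  by move=> i _; have [] := lO i.
have sOO i : O i \subset OO by apply: (bigcup_sup i).
have dOO : [disjoint OO & Y :|: Z].
  rewrite disjoint_sym; apply/bigcup_disjointP => i _; rewrite disjoint_sym.
  by have [] := lO i.
have dOOZ : [disjoint OO & Z] by apply: disjointWr dOO; apply: subsetUr.
have sZV : Z \subset U :\: OO.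
  apply/subsetP => z zZ; have /setDP [zU _] := subsetP sZ z zZ.
  by rewrite in_setD zU (disjointFl dOOZ zZ).
have cut (L : {set T}) : [disjoint L & Y] -> k <= #|out_bd (arcs_in a (U :\: OO)) Z L|.
  apply: (linkers_cut (c := c) sZ sYU cY).
  - by rewrite cZ; lia.
  - by apply: dpath_connected conn _; rewrite cX.
  - by move=> i; have [] := lO i.
  - move=> i j u v L' nij uO vO tL ub vb.
    have notY i' w : w \in O i' :&: ~: core a U Z Y c -> w \notin Y.
      case/setIP => /(subsetP (sOO i')) wO _.
      by have := disjointFr dOO wO; rewrite in_setU => /norP [].
    have [_ h] := confO i j (in_setT i) (in_setT j) nij.
    case: (h u v uO vO) => [] [lvu /negP]; apply.
    + exact: (confl u v L' tL ub vb (notY i u uO) lvu).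
    + exact: (confl v u L' tL vb ub (notY j v vO) lvu).
  by apply: leq_trans ar2; rewrite leq_add2l.
have [s [p sp_min]] := shortest_linkage_exists ys_inj cut.
pose R := linkage_verts s p.
pose Con i (M : {set T}) := exists q, [/\ path a (xs i) (rcons q (s i)), uniq q,
    {in q, forall v, v \in O i \/ v \in M} &
    M \subset U :\: (R :|: OO) /\ #|M| <= 3].
(* With [N] empty the greedy choice only makes the connections disjoint; each uses at most three
   vertices outside the reserved sets. *)
have [||||M [conM disjM]] := @greedy_choice 'I_k T Con set0 (fun=> 0) (fun=> set0) 3 0 (3 * k)
    _ _ _ [set: 'I_k] set0.
- by move=> i M [_ [_ _ _ []]]; rewrite setI0 cards0.
- by move=> v; rewrite cards0.
- move=> i F cF.
  have [|||q' [M [h1 h2 h3 h4 [h5 h6]]]] := connect_to_linkage (Us := F) (D := d - k) i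
    irr sc sZ topZ dOOZ sp_min (lO i) (sOO i).
  + by rewrite /b; lia.
  + exact: degU.
  + apply: leq_trans (subk _ ar4); rewrite leq_add2r leq_mul2l cZ.
    by apply: leq_add cF; rewrite leq_add2r leq_add2l.
  by exists M; split=> //; exists q'.
- by rewrite cards0 cardsT card_ord; lia.
have /fin_all_exists [r rP] : forall i, Con i (M i).
  by move=> i; have [] := conM i (in_setT i).
have [[pf lastp] _] := sp_min.
have pR i v : v \in s i :: p i -> v \in R by move=> vi; apply/linkage_vertsP; exists i.
have RV v : v \in R -> v \in U /\ v \notin OO.
  by move/(subsetP (linkage_verts_sub sZV sp_min)) => /setDP.
have MP i v : v \in M i -> [/\ v \in U, v \notin R & v \notin OO].
  have [_ _ _ [sM _]] := rP i; move/(subsetP sM).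
  by rewrite in_setD in_setU => /andP [/norP [vR vO] vU].
have rOM i v : v \in r i -> v \in O i \/ v \in M i by have [_ _ h _] := rP i; apply: h.
have rU i v : v \in r i -> v \in U /\ v \notin R.
  case/rOM=> [vO|/MP [] //]; have [sO _ _ _ _] := lO i.
  split; first exact: (subsetP sO).
  by apply/negP => /RV [_]; rewrite (subsetP (sOO i)).
have xU i : xs i \notin U by rewrite in_setC negbK imset_f.
have memU i v : v \in r i ++ s i :: p i -> v \in U.
  by rewrite mem_cat => /orP [/rU []|/pR /RV []].
have disjr i j v : i != j -> v \in r i -> v \notin r j.
  move=> nij /rOM vi; apply/negP => /rOM vj.
  have [dO _] := confO i j (in_setT i) (in_setT j) nij.
  have [dM _] := disjM i j (in_setT i) (in_setT j) nij.
  case: vi => vi; case: vj => vj.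
  - by rewrite (disjointFr dO vi) in vj.
  - by have [_ _] := MP j v vj; rewrite (subsetP (sOO i)).
  - by have [_ _] := MP i v vi; rewrite (subsetP (sOO j)).
  - by rewrite (disjointFr dM vi) in vj.
exists (fun i => r i ++ s i :: p i); split=> [i|i j nij].
  have [pr ur _ _] := rP i; apply/and3P; split.
  - rewrite -cat_rcons cat_path pr last_rcons.
    apply: sub_path (pf_path pf (in_setT i)) => u v.
    by rewrite arc_arcs_in => /and3P [].
  - by rewrite last_cat /= lastp.
  rewrite cons_uniq; apply/andP; split; first by apply: contra (xU i); apply: memU.
  rewrite cat_uniq ur (pf_uniq pf (in_setT i)) andbT; apply/hasPn => v /pR vR.
  by apply/negP => /rU []; rewrite vR.
apply/pred0P => v /=; apply/negP => /andP [].
rewrite !in_cons => /predU1P [->|vi] /predU1P [e|vj].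
- by case/eqP: nij; apply: xs_inj.
- by have := xU i; rewrite (memU j).
- by have := xU j; rewrite -e (memU i).
move: vi vj; rewrite !mem_cat => /orP [vi|vi] /orP [vj|vj].
- by have := disjr i j v nij vi; rewrite vj.
- by have [_] := rU i v vi; rewrite (pR j).
- by have [_] := rU j v vj; rewrite (pR i).
by case/eqP: nij; apply: (pf_disj pf (in_setT i) (in_setT j) vi vj).
Qed.
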